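(* Let $X,Y,Z$ be random elements of measurable spaces $\mathscr{X},\mathscr{Y},\mathscr{Z}$. (i) Let $(\mathscr{X},\rho_{\mathscr{X}})$ and $(\mathscr{Y},\rho_{\mathscr{Y}})$ be semimetric spaces of negative type. Suppose that for all $z\in\mathscr{Z}$, $X|Z=z\sim P_{X|Z=z}\in\mathcal{M}^2_{\rho_{\mathscr{X}}}(\mathscr{X})$ and $Y|Z=z\sim P_{Y|Z=z}\in\mathcal{M}^2_{\rho_{\mathscr{Y}}}(\mathscr{Y})$, with joint distribution $P_{XY|Z=z}$. If $k_{\mathscr{X}}$ and $k_{\mathscr{Y}}$ are positive definite kernels on $\mathscr{X}$ and $\mathscr{Y}$ that are distance-induced, i.e. $$k_{\mathscr{X}}(x,x')=\rho_{\mathscr{X}}(x,\theta)+\rho_{\mathscr{X}}(x',\theta)-\rho_{\mathscr{X}}(x,x'),\qquad k_{\mathscr{Y}}(y,y')=\rho_{\mathscr{Y}}(y,\theta')+\rho_{\mathscr{Y}}(y',\theta')-\rho_{\mathscr{Y}}(y,y')$$ for some $\theta\in\mathscr{X}$ and $\theta'\in\mathscr{Y}$, then for all $z\in\mathscr{Z}$ $$\mathcal{V}^2_{\rho_{\mathscr{X}},\rho_{\mathscr{Y}}}(X,Y|Z=z)=\mathcal{D}^2_{k_{\mathscr{X}}k_{\mathscr{Y}}}\big(P_{XY|Z=z},\,P_{X|Z=z}P_{Y|Z=z}\big).\qquad( * )$$ (ii) Conversely, suppose $k_{\mathscr{X}}$ and $k_{\mathscr{Y}}$ are positive definite kernels on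 $\mathscr{X}$ and $\mathscr{Y}$, and that for all $z\in\mathscr{Z}$, $X|Z=z\sim P_{X|Z=z}\in\mathcal{M}^2_{k_{\mathscr{X}}}(\mathscr{X})$ and $Y|Z=z\sim P_{Y|Z=z}\in\mathcal{M}^2_{k_{\mathscr{Y}}}(\mathscr{Y})$, with joint distribution $P_{XY|Z=z}$. If $\rho_{\mathscr{X}}$ and $\rho_{\mathscr{Y}}$ are semimetrics on $\mathscr{X}$ and $\mathscr{Y}$ that are kernel-induced, i.e. $$\rho_{\mathscr{X}}(x,x')=\frac{k_{\mathscr{X}}(x,x)+k_{\mathscr{X}}(x',x')}{2}-k_{\mathscr{X}}(x,x'),\qquad \rho_{\mathscr{Y}}(y,y')=\frac{k_{\mathscr{Y}}(y,y)+k_{\mathscr{Y}}(y',y')}{2}-k_{\mathscr{Y}}(y,y'),$$ then $( * )$ holds for all $z\in\mathscr{Z}$.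
   Context: Semimetric: $\rho:\mathscr{X}\times\mathscr{X}\to[0,\infty)$ with $\rho(x,x')=0\Leftrightarrow x=x'$ and $\rho(x,x')=\rho(x',x)$. $(\mathscr{X},\rho)$ is of negative type if for all $n\ge 2$, $x_1,\dots,x_n\in\mathscr{X}$ and real $\alpha_1,\dots,\alpha_n$ with $\sum_i\alpha_i=0$, one has $\sum_{i,j}\alpha_i\alpha_j\rho(x_i,x_j)\le 0$. A positive definite kernel is a symmetric function $k:\mathscr{X}\times\mathscr{X}\to\mathbb{R}$ with $\sum_{i,j}\alpha_i\alpha_jk(x_i,x_j)\ge 0$ for all finite families; all kernels are assumed measurable. $\mathscr{H}_k$ denotes the RKHS with reproducing kernel $k$. $\mathcal{M}(\mathscr{X})$ is the set of finite signed Borel measures on $\mathscr{X}$; $\mathcal{M}^{r}_{\rho}(\mathscr{X})=\{v\in\mathcal{M}(\mathscr{X}):\int\rho^{r}(x,x_0)\,d|v|(x)<\infty\text{ for some }x_0\in\mathscr{X}\}$ and $\mathcal{M}^{r}_{k}(\mathscr{X})=\{v\in\mathcal{M}(\mathscr{X}):\int k^{r}(x,x)\,d|v|(x)<\infty\}$. $P_{XY|Z=z}$ is the conditional law of $(X,Y)$ given $Z=z$, with marginals $P_{X|Z=z}$, $P_{Y|Z=z}$; $P_{X|Z=z}P_{Y|Z=z}$ is their product measure. Generalized conditional distance covariance: with $(X,Y),(X',Y')$ i.i.d. from $P_{XY|Z=z}$ (all expectations conditional on $Z=z$), $$\mathcal{V}^2_{\rho_{\mathscr{X}},\rho_{\mathscr{Y}}}(X,Y|Z=z)=\mathbb{E}_{XY}\mathbb{E}_{X'Y'}\rho_{\mathscr{X}}(X,X')\rho_{\mathscr{Y}}(Y,Y')+\mathbb{E}_X\mathbb{E}_{X'}\rho_{\mathscr{X}}(X,X')\,\mathbb{E}_Y\mathbb{E}_{Y'}\rho_{\mathscr{Y}}(Y,Y')-2\,\mathbb{E}_{XY}\big[\mathbb{E}_{X'}\rho_{\mathscr{X}}(X,X')\,\mathbb{E}_{Y'}\rho_{\mathscr{Y}}(Y,Y')\big],$$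 equivalently $\int\int\rho_{\mathscr{X}}(x,x')\rho_{\mathscr{Y}}(y,y')\,dv_z(x,y)\,dv_z(x',y')$ with $v_z=P_{XY|Z=z}-P_{X|Z=z}P_{Y|Z=z}$. Kernel distance: for probability measures $P,Q$ on $\mathscr{X}\times\mathscr{Y}$, $\mathcal{D}_{k_{\mathscr{X}}k_{\mathscr{Y}}}(P,Q)=\|\mu_P-\mu_Q\|$, where $\mu_P=\int k_{\mathscr{X}}(\cdot,x)k_{\mathscr{Y}}(\cdot,y)\,dP(x,y)$ is the mean embedding in the RKHS $\mathscr{H}_{k_{\mathscr{X}}}\otimes\mathscr{H}_{k_{\mathscr{Y}}}$ of the product kernel $(k_{\mathscr{X}}k_{\mathscr{Y}})((x,y),(x',y'))=k_{\mathscr{X}}(x,x')k_{\mathscr{Y}}(y,y')$; equivalently $\mathcal{D}^2_{k_{\mathscr{X}}k_{\mathscr{Y}}}(P,Q)=\int\int k_{\mathscr{X}}(x,x')k_{\mathscr{Y}}(y,y')\,d(P-Q)(x,y)\,d(P-Q)(x',y')$. *)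

(* Defs.v *)
From HB Require Import structures.
From mathcomp Require Import all_boot all_order all_algebra sesquilinear.
From mathcomp Require Import all_classical all_reals all_analysis measurable_realfun.

Set Implicit Arguments.
Unset Strict Implicit.
Unset Printing Implicit Defensive.

Import Order.TTheory GRing.Theory Num.Theory.
Import numFieldNormedType.Exports.

Local Open Scope classical_set_scope.
Local Open Scope ring_scope.

Section semimetrics_and_kernels.
Context {R : realType} {T : Type}.
Implicit Types rho k : T -> T -> R.

Definition semimetric rho :=
  [/\ forall x x', 0 <= rho x x',
      forall x x', rho x x' = 0 <-> x = x' &
      forall x x', rho x x' = rho x' x].

Definition negative_type rho :=
  forall (n : nat) (x : 'I_n -> T) (a : 'I_n -> R), (2 <= n)%N ->
    \sum_i a i = 0 -> \sum_i \sum_j a i * a j * rho (x i) (x j) <= 0.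

Definition posdef_kernel k :=
  (forall x x', k x x' = k x' x) /\
  (forall (n : nat) (x : 'I_n -> T) (a : 'I_n -> R),
    0 <= \sum_i \sum_j a i * a j * k (x i) (x j)).

Definition distance_induced rho k :=
  exists theta, forall x x', k x x' = rho x theta + rho x' theta - rho x x'.

Definition kernel_induced k rho :=
  forall x x', rho x x' = (k x x + k x' x') / 2 - k x x'.

End semimetrics_and_kernels.

Definition prod_kernel {R : realType} {T1 T2 : Type}
    (k1 : T1 -> T1 -> R) (k2 : T2 -> T2 -> R) (w w' : T1 * T2) : R :=
  k1 w.1 w'.1 * k2 w.2 w'.2.

Definition jointly_measurable {d} {T : measurableType d} {R : realType}
    (k : T -> T -> R) :=
  measurable_fun [set: T * T] (fun w => k w.1 w.2).

(* The Hilbert space of functions on T with reproducing kernel k, presented as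
   an abstract real Hilbert space together with its embedding into T -> R.
   Linearity of rkhs_fun is a consequence of the reproducing property, and two
   such spaces for the same k are isometric via rkhs_fun. *)
Structure rkhs (R : realType) (T : Type) (k : T -> T -> R) := RKHS {
  rkhs_space :> completeNormedModType R;
  rkhs_dot : {dot rkhs_space for idfun};
  rkhs_dotE : forall f : rkhs_space, rkhs_dot f f = `|f| ^+ 2;
  rkhs_fun : rkhs_space -> T -> R;
  rkhs_fun_inj : injective rkhs_fun;
  rkhs_section : T -> rkhs_space;
  rkhs_sectionE : forall x, rkhs_fun (rkhs_section x) = k ^~ x;
  rkhs_reproducing : forall (f : rkhs_space) x,
    rkhs_fun f x = rkhs_dot f (rkhs_section x)
}.

Section kernel_distance.
Context {d} {T : measurableType d} {R : realType} {k : T -> T -> R}.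
Variable H : rkhs k.
Implicit Types P Q : probability T R.

(* m is the weak integral of x |-> k(., x) with respect to P; there is at most
   one such m, since rkhs_dot is definite. *)
Definition is_mean_embedding P (m : H) :=
  forall f : H, P.-integrable [set: T] (EFin \o rkhs_fun f) /\
    (rkhs_dot H f m)%:E = (\int[P]_x (rkhs_fun f x)%:E)%E.

Definition has_mean_embedding P := exists m, is_mean_embedding P m.

(* The default value 0 is taken only when ~ has_mean_embedding P. *)
Definition mean_embedding P : H := xget 0 [set m | is_mean_embedding P m].

Definition kernel_distance P Q : R :=
  `|mean_embedding P - mean_embedding Q|.

End kernel_distance.

(* For a probability measure v, the variation |v| is v itself. *)
Section moment_classes.
Context {d} {T : measurableType d} {R : realType}.

Definition moment_rho (r : nat) (rho : T -> T -> R) : set (probability T R) :=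
  [set v : probability T R |
    exists x0, (\int[v]_x (rho x x0 ^+ r)%:E < +oo)%E].

Definition moment_k (r : nat) (k : T -> T -> R) : set (probability T R) :=
  [set v : probability T R | (\int[v]_x (k x x ^+ r)%:E < +oo)%E].

End moment_classes.

HB.instance Definition _ d1 d2 (T1 : measurableType d1)
    (T2 : measurableType d2) :=
  isMeasurableFun.Build _ _ (T1 * T2)%type T1 fst measurable_fst.
HB.instance Definition _ d1 d2 (T1 : measurableType d1)
    (T2 : measurableType d2) :=
  isMeasurableFun.Build _ _ (T1 * T2)%type T2 snd measurable_snd.

Section joint_laws.
Context {d1 d2} {T1 : measurableType d1} {T2 : measurableType d2}.
Context {R : realType}.
Variable P : probability (T1 * T2)%type R.

Definition law1 : probability T1 R := distribution P fst.
Definition law2 : probability T2 R := distribution P snd.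
Definition law_prod : probability (T1 * T2)%type R := (law1 \x law2)%E.

(* The squared distance covariance of a pair of law P. For nonnegative rho1 and
   rho2 the three terms lie in [0, +oo]; since +oo - +oo = -oo in \bar R, the
   whole expression is finite only if each of them is. *)
Definition dcov2 (rho1 : T1 -> T1 -> R) (rho2 : T2 -> T2 -> R) : \bar R :=
  (\int[P]_w \int[P]_w' (rho1 w.1 w'.1 * rho2 w.2 w'.2)%:E
   + (\int[law1]_x \int[law1]_x' (rho1 x x')%:E)
     * (\int[law2]_y \int[law2]_y' (rho2 y y')%:E)
   - 2%:E * \int[P]_w ((\int[law1]_x' (rho1 w.1 x')%:E)
                       * (\int[law2]_y' (rho2 w.2 y')%:E)))%E.

End joint_laws.

(* kappa is a regular version of the conditional law of X given Z. *)
Definition is_cond_law {d dT dZ} {Omega : measurableType d}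
    {T : measurableType dT} {S : measurableType dZ} {R : realType}
    (P : probability Omega R) (X : Omega -> T) (Z : {mfun Omega >-> S})
    (kappa : S -> probability T R) :=
  (forall A, measurable A -> measurable_fun [set: S] (fun z => kappa z A)) /\
  (forall (A : set T) (C : set S), measurable A -> measurable C ->
    P (X @^-1` A `&` Z @^-1` C) =
    (\int[distribution P Z]_(z in C) kappa z A)%E).

(* Main.v *)
Require Import Defs.
From mathcomp Require Import all_boot all_order all_algebra sesquilinear.
From mathcomp Require Import all_classical all_reals all_analysis measurable_realfun.
From mathcomp Require Import ring lra.

Set Implicit Arguments.
Unset Strict Implicit.
Unset Printing Implicit Defensive.

Import Order.TTheory GRing.Theory Num.Theory.
Import numFieldNormedType.Exports.

Local Open Scope classical_set_scope.
Local Open Scope ring_scope.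

(** Write [P] for one conditional law [PXY z] and [Q] for the product of its
    marginals. Both sides of the identity are an energy
      [\int\int h dP dP + \int\int h dQ dQ - 2 \int\int h dP dQ],
    that is [\int\int h d(P - Q) d(P - Q)] for symmetric [h]. For the kernel
    distance, [h] is the product kernel: the reproducing property turns
    [<mu_P, mu_Q>] into [\int\int h dP dQ] ([kernel_distance_sqrE]). For the
    distance covariance, [h] is [rho1 rho2]: by Tonelli an integral of [h] against
    [Q] splits into a product over the two marginals ([dcov2_energy]).

    The two energies agree ([energy_kernel_induced]). Indeed
    [rho(x, x') = a(x) + a(x') - k(x, x')] with [a(x) = k(x, x) / 2], so
    [rho1 rho2 - k1 k2] is a sum of functions in which, up to exchanging the two
    points, the second point occurs through one coordinate only. As [P] and [Q]
    have the same marginals, such functions integrate to zero against [P - Q] in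
    the second point ([energy_sym_eq0]).

    The integrals make sense because [P] and [Q] are couplings of the same
    marginals and all kernels involved are bounded by [k(x, x) + k(x', x')], whose
    square is integrable ([integrable_prod_kernel]). The mean embedding of [P]
    exists by the Riesz representation theorem applied to [f |-> \int f dP]
    ([mean_embedding_exists]). That this integral is defined for each [f] needs
    every function of the space to be measurable ([measurable_rkhs_fun]): the
    measurable ones form a closed subspace containing all the sections [k(., x)],
    whose orthogonal complement is zero. So the Riesz theorem is proved on a
    sequentially closed subspace, which yields orthogonal projections as well.

    Finally a distance-induced kernel has [k(x, x) = 2 rho(x, theta)], hence
    induces [rho] in turn, and negative type gives a relaxed triangle inequality
    that moves the second moment of [rho] from any base point to [theta]. Part (i)
    thereby reduces to part (ii). *)

(** * Riesz representation in a real Hilbert space *)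

Section hilbert.
Context {R : realType} {V : completeNormedModType R} (dot : {dot V for idfun}).
Hypothesis dotE : forall f : V, dot f f = `|f| ^+ 2.
Implicit Types f g : V.

Lemma dotC f g : dot f g = dot g f.
Proof. by rewrite hermC expr0 mul1r. Qed.

Lemma normD2 f g : `|f + g| ^+ 2 = `|f| ^+ 2 + `|g| ^+ 2 + 2 * dot f g.
Proof.
rewrite -!dotE linearDl/= !linearDr/= (dotC g f); ring.
Qed.

Lemma dotZl a f g : dot (a *: f) g = a * dot f g.
Proof. by rewrite linearZl_LR. Qed.

Lemma dotZr a f g : dot f (a *: g) = a * dot f g.
Proof. by rewrite dotC dotZl dotC. Qed.

Lemma normB2 f g : `|f - g| ^+ 2 = `|f| ^+ 2 + `|g| ^+ 2 - 2 * dot f g.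
Proof. by rewrite normD2 normrN -scaleN1r dotZr; ring. Qed.

Lemma sqr_dot_le f g : dot f g ^+ 2 <= `|f| ^+ 2 * `|g| ^+ 2.
Proof.
have [->|g0] := eqVneq g 0.
  by rewrite linear0r normr0 expr0n/= mulr0.
have g2 : 0 < `|g| ^+ 2 by rewrite exprn_gt0// normr_gt0.
have := sqr_ge0 `|f - (dot f g / `|g| ^+ 2) *: g|.
rewrite normB2 dotZr -!(dotE (_ *: g)) dotZl dotZr dotE => h.
rewrite -subr_ge0.
have -> : `|f| ^+ 2 * `|g| ^+ 2 - dot f g ^+ 2 = `|g| ^+ 2 * (`|f| ^+ 2 +
    dot f g / `|g| ^+ 2 * (dot f g / `|g| ^+ 2 * `|g| ^+ 2) -
    2 * (dot f g / `|g| ^+ 2 * dot f g)) by field; rewrite normr_eq0.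
by rewrite mulr_ge0// ltW.
Qed.

Lemma cauchy_schwarz f g : `|dot f g| <= `|f| * `|g|.
Proof.
by rewrite -ler_sqr ?nnegrE ?mulr_ge0// real_normK ?num_real// exprMn sqr_dot_le.
Qed.

(** A minimiser of [|f|^2 - 2 L f] over the subspace represents [L]. By the
    parallelogram law every minimising sequence is Cauchy; its limit [m] satisfies
    the Euler equation because each term [u n] satisfies it up to an error
    controlled by how close [Phi (u n)] is to the infimum. *)
Theorem riesz_representation (F : set V) (L : V -> R) (C : R) :
  F 0 -> (forall a f g, F f -> F g -> F (a *: f + g)) ->
  (forall (u : V^nat) f, (forall n, F (u n)) -> u @ \oo --> f -> F f) ->
  (forall a f g, F f -> F g -> L (a *: f + g) = a * L f + L g) ->
  (forall f, F f -> `|L f| <= C * `|f|) ->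
  exists2 m, F m & forall f, F f -> dot f m = L f.
Proof.
move=> F0 FD Fcl LD Lbnd.
pose Phi f : R := `|f| ^+ 2 - 2 * L f.
have Phi_lb : lbound [set Phi f | f in F] (- C ^+ 2).
  move=> _ [f Ff <-]; rewrite /Phi -subr_ge0.
  have Lf : L f <= C * `|f| by rewrite (le_trans (ler_norm _))// Lbnd.
  have -> : `|f| ^+ 2 - 2 * L f - - C ^+ 2 =
    (`|f| - C) ^+ 2 + 2 * (C * `|f| - L f) by ring.
  by rewrite addr_ge0 ?sqr_ge0// mulr_ge0// subr_ge0.
have hinf : has_inf [set Phi f | f in F].
  by split; [exists (Phi 0), 0|exists (- C ^+ 2)].
pose I := inf [set Phi f | f in F].
have PhiI f : F f -> I <= Phi f by move=> Ff; apply: ge_inf; [case: hinf|exists f].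
have /choice[u uP] (n : nat) : exists f, F f /\ Phi f < I + n.+1%:R^-1.
  have [|_ [f Ff <-] h] := inf_adherent _ hinf (eps := n.+1%:R^-1).
    by rewrite invr_gt0.
  by exists f.
have Fu n : F (u n) by have [] := uP n.
have FB f g : F f -> F g -> F (f + g) by move=> Ff Fg; rewrite -(scale1r f); exact: FD.
have FZ a f : F f -> F (a *: f) by move=> Ff; rewrite -(addr0 (a *: f)); exact: FD.
have L0 : L 0 = 0.
  have := LD 1 0 0 F0 F0; rewrite scale1r addr0 mul1r => h; lra.
have LZ a f : F f -> L (a *: f) = a * L f.
  by move=> Ff; have := LD a f 0 Ff F0; rewrite !addr0 L0 addr0.
have LB f g : F f -> F g -> L (f + g) = L f + L g.
  by move=> Ff Fg; have := LD 1 f g Ff Fg; rewrite scale1r mul1r.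
(* Apply [PhiI] to the midpoint of [u p] and [u q], then the parallelogram law. *)
have dist_u p q : `|u p - u q| ^+ 2 <= 2 * (p.+1%:R^-1 + q.+1%:R^-1).
  have := PhiI _ (FZ 2^-1 _ (FB _ _ (Fu p) (Fu q))).
  have [_] := uP p; have [_] := uP q.
  rewrite /Phi LZ ?LB//; last exact: FB.
  rewrite -(dotE (_ *: _)) dotZl dotZr dotE (normD2 (u p)) normB2.
  move: (p.+1%:R^-1) (q.+1%:R^-1) => a b; lra.
have cu : cvgn u.
  apply: cauchy_cvg; apply: cauchy_exP => e e0.
  have e2 : 0 < e ^+ 2 / 4 by rewrite divr_gt0 ?exprn_gt0.
  have [N _ HN] := near_infty_natSinv_lt (PosNum e2).
  exists (u N); exists N => // n/= Nn.
  rewrite -ball_normE /ball_/= -ltr_sqr ?nnegrE// ?ltW//.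
  apply: le_lt_trans (dist_u N n) _.
  have /= := HN _ Nn; have /= := HN _ (leqnn N).
  move: (N.+1%:R^-1) (n.+1%:R^-1) => a b; lra.
pose m := limn u.
have um : u @ \oo --> m by [].
exists m; first exact: Fcl Fu um.
move=> f Ff; apply/eqP; rewrite -subr_eq0 -sqrf_eq0 eq_le sqr_ge0 andbT.
(* Compare [Phi (u n)] with [Phi (u n + a *: f)] for the optimal step [a]. *)
have near_min n : (dot f (u n) - L f) ^+ 2 <= n.+1%:R^-1 * `|f| ^+ 2.
  set t := dot f (u n) - L f.
  have [f0|f0] := eqVneq f 0.
    by rewrite /t f0 L0 linear0l subrr normr0 expr0n/= mulr0.
  have f2 : 0 < `|f| ^+ 2 by rewrite exprn_gt0// normr_gt0.
  pose a := - t / `|f| ^+ 2.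
  have := PhiI _ (FD a _ _ Ff (Fu n)); have [_] := uP n.
  rewrite /Phi LD// normD2 -!(dotE (a *: f)) !dotZl dotZr dotE => h1 h2.
  have ta : a * `|f| ^+ 2 = - t by rewrite /a; field; rewrite normr_eq0.
  have : t ^+ 2 / `|f| ^+ 2 <= n.+1%:R^-1; last by rewrite ler_pdivrMr.
  have -> : t ^+ 2 / `|f| ^+ 2 = - (t * a) by rewrite /a; field; rewrite normr_eq0.
  move: h1 h2; rewrite ta /t; move: (n.+1%:R^-1) => b; clearbody a; lra.
have bound n : (dot f m - L f) ^+ 2 <=
    2 * `|f| ^+ 2 * (`|m - u n| ^+ 2 + harmonic n).
  have -> : dot f m - L f = dot f (m - u n) + (dot f (u n) - L f).
    by rewrite linearBr/=; ring.
  have h1 := near_min n; have h2 := sqr_dot_le f (m - u n).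
  have := sqr_ge0 (dot f (m - u n) - (dot f (u n) - L f)).
  rewrite /harmonic/=; move: h1 h2; move: (n.+1%:R^-1) => b; lra.
have lim0 : 2 * `|f| ^+ 2 * (`|m - u n| ^+ 2 + harmonic n) @[n --> \oo] --> 0.
  rewrite -[X in _ --> X](mulr0 (2 * `|f| ^+ 2)).
  apply: cvgMr; rewrite -[X in _ --> X](addr0 0).
  apply: cvgD; last exact: cvg_harmonic.
  have -> : 0 = `|m - m| ^+ 2 :> R by rewrite subrr normr0 expr0n.
  apply: (@cvg_comp _ _ _ _ (fun x : R => x ^+ 2)); last exact: exprn_continuous.
  by apply: cvg_norm; apply: cvgB => //; exact: cvg_cst.
rewrite -(cvg_lim _ lim0)//; apply: limr_ge; first by apply/cvg_ex; exists 0.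
by near=> n; exact: bound.
Unshelve. all: by end_near. Qed.

End hilbert.

(** * Reproducing kernel Hilbert spaces and mean embeddings *)

Section rkhs_theory.
Context {R : realType} {T : Type} {k : T -> T -> R} (H : rkhs k).
Implicit Types f g : H.

Lemma rkhs_fun_linear a f g x :
  rkhs_fun (a *: f + g) x = a * rkhs_fun f x + rkhs_fun g x.
Proof. by rewrite !rkhs_reproducing linearPl. Qed.

Lemma rkhs_norm_section x : `|rkhs_section H x| = Num.sqrt (k x x).
Proof.
have -> : k x x = rkhs_fun (rkhs_section H x) x by rewrite rkhs_sectionE.
by rewrite rkhs_reproducing rkhs_dotE sqrtr_sqr normr_id.
Qed.

Lemma rkhs_fun_le f x : `|rkhs_fun f x| <= `|f| * Num.sqrt (k x x).
Proof.
rewrite -rkhs_norm_section rkhs_reproducing.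
exact: cauchy_schwarz (@rkhs_dotE _ _ _ H) _ _.
Qed.

Lemma rkhs_fun_cvg (u : H^nat) f x :
  u @ \oo --> f -> rkhs_fun (u n) x @[n --> \oo] --> rkhs_fun f x.
Proof.
move=> uf; apply/cvgrPdist_lt => e e0 /=.
have c0 : 0 < Num.sqrt (k x x) + 1 by rewrite ltr_wpDl ?sqrtr_ge0.
have /cvgrPdist_lt/(_ (e / (Num.sqrt (k x x) + 1))) := uf.
rewrite divr_gt0// => /(_ isT); apply: filterS => n /=.
rewrite ltr_pdivlMr// => h; apply: le_lt_trans h.
have -> : rkhs_fun f x - rkhs_fun (u n) x = rkhs_fun (f - u n) x.
  by rewrite !rkhs_reproducing linearBl.
by rewrite (le_trans (rkhs_fun_le _ _))// ler_wpM2l// lerDl.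
Qed.

End rkhs_theory.

Section mean_embedding_theory.
Context {d} {T : measurableType d} {R : realType} {k : T -> T -> R}.
Variable H : rkhs k.
Hypothesis mk : forall x, measurable_fun [set: T] (k ^~ x).
Implicit Types P Q : probability T R.

(** Project [f] orthogonally on the closed subspace of the measurable functions.
    The sections belong to it, so by the reproducing property [f] and its
    projection have the same values. *)
Lemma measurable_rkhs_fun (f : H) : measurable_fun [set: T] (rkhs_fun f).
Proof.
pose F := [set g : H | measurable_fun [set: T] (rkhs_fun g)].
have FD a g h : F g -> F h -> F (a *: g + h).
  rewrite /F/= => mg mh; rewrite (_ : rkhs_fun _ = (cst a \* rkhs_fun g) \+ rkhs_fun h).
    by apply: measurable_funD => //; exact: measurable_funM.
  by apply/funext => x /=; rewrite rkhs_fun_linear.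
have F0 : F 0.
  rewrite /F/= (_ : rkhs_fun _ = cst 0) //.
  by apply/funext => x /=; rewrite rkhs_reproducing linear0l.
have Fcl (u : H^nat) g : (forall n, F (u n)) -> u @ \oo --> g -> F g.
  move=> Fu ug; apply: (measurable_fun_cvg Fu) => x _.
  exact: rkhs_fun_cvg.
have [||m Fm mE] := riesz_representation (@rkhs_dotE _ _ _ H) (F := F)
    (L := fun g => rkhs_dot H g f) (C := `|f|) F0 FD Fcl.
- by move=> a g h _ _; rewrite linearPl.
- by move=> g _; rewrite mulrC; exact: cauchy_schwarz (@rkhs_dotE _ _ _ H) _ _.
suff -> : f = m by [].
apply: (@rkhs_fun_inj _ _ _ H); apply/funext => x.
rewrite !rkhs_reproducing (dotC _ f) (dotC _ m) mE//.
by rewrite /F/= rkhs_sectionE.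
Qed.

(** By [rkhs_fun_le], the functional [f |-> \int f dP] is bounded by the integral
    of [sqrt (k(x, x))], so it is represented by a vector. *)
Lemma mean_embedding_exists P :
  P.-integrable [set: T] (EFin \o (fun x => Num.sqrt (k x x))) ->
  has_mean_embedding H P.
Proof.
move=> ik.
have ikf (f : H) : P.-integrable [set: T] (EFin \o rkhs_fun f).
  apply: (@le_integrable _ _ _ P _ measurableT _
    (EFin \o (fun x => Num.sqrt (k x x) * `|f|))) => //.
  - by apply/measurable_EFinP; exact: measurable_rkhs_fun.
  - move=> x _ /=; rewrite lee_fin [leRHS]ger0_norm ?mulr_ge0 ?sqrtr_ge0//.
    by rewrite mulrC; exact: rkhs_fun_le.
  - exact: (integrableZr measurableT (`|f| : R) ik).
have [|||||m _ mE] := riesz_representation (@rkhs_dotE _ _ _ H) (F := setT)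
    (L := fun f => \int[P]_x rkhs_fun f x) (C := \int[P]_x Num.sqrt (k x x)) => //.
- move=> a f g _ _; under eq_Rintegral do rewrite rkhs_fun_linear.
  rewrite RintegralD ?RintegralZl//.
  exact: (integrableZl measurableT a (ikf f)).
- move=> f _; rewrite (le_trans (le_normr_Rintegral measurableT (ikf f)))//.
  rewrite mulrC -RintegralZl//; apply: le_Rintegral => //.
  + by apply: integrable_norm.
  + exact: (integrableZl measurableT (`|f| : R) ik).
  + by move=> x _; exact: rkhs_fun_le.
exists m => f; split => //.
by rewrite mE// /Rintegral fineK//; exact: integrable_fin_num (ikf f).
Qed.

Lemma mean_embeddingP P :
  has_mean_embedding H P -> is_mean_embedding P (mean_embedding H P).
Proof. exact: xgetPex. Qed.

Lemma dot_mean_embedding P Q : has_mean_embedding H P -> has_mean_embedding H Q ->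
  (rkhs_dot H (mean_embedding H P) (mean_embedding H Q))%:E =
  (\int[Q]_y \int[P]_x (k x y)%:E)%E.
Proof.
move=> /mean_embeddingP hP /mean_embeddingP hQ.
rewrite (hQ _).2; apply: eq_integral => y _.
by rewrite rkhs_reproducing dotC (hP _).2 rkhs_sectionE.
Qed.

End mean_embedding_theory.

(** * Energy of a pair of laws *)

Section energy.
Context {d} {T : measurableType d} {R : realType}.
Implicit Types (P Q : probability T R) (h g : T * T -> R).

(** The double integral of [h] against the signed measure [P - Q], when [h] is
    symmetric. *)
Definition energy P Q h : R :=
  \int[(P \x P)%E]_w h w + \int[(Q \x Q)%E]_w h w - 2 * \int[(P \x Q)%E]_w h w.

Definition pair_integrable P Q h :=
  forall mu nu, (mu = P \/ mu = Q) -> (nu = P \/ nu = Q) ->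
    (mu \x nu)%E.-integrable [set: T * T] (EFin \o h).

Lemma energyD P Q h g : pair_integrable P Q h -> pair_integrable P Q g ->
  energy P Q (fun w => h w + g w) = energy P Q h + energy P Q g.
Proof.
move=> ih ig; rewrite /energy !RintegralD//; first by ring.
all: by first [apply: ih | apply: ig]; auto.
Qed.

Lemma energyB P Q h g : pair_integrable P Q h -> pair_integrable P Q g ->
  energy P Q (fun w => h w - g w) = energy P Q h - energy P Q g.
Proof.
move=> ih ig; rewrite /energy !RintegralB//; first by ring.
all: by first [apply: ih | apply: ig]; auto.
Qed.

(** If [P - Q] annihilates [g(w, .)] for all [w], then the integral of [g] against
    [mu \x nu] does not depend on [nu], say it is [G mu], and the symmetrisation
    of [g] has energy [2 G P + 2 G Q - 2 (G P + G Q) = 0]. *)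
Lemma energy_sym_eq0 P Q g :
  pair_integrable P Q g -> pair_integrable P Q (fun w => g (w.2, w.1)) ->
  (forall w, \int[P]_w' (g (w, w'))%:E = \int[Q]_w' (g (w, w'))%:E)%E ->
  energy P Q (fun w => g w + g (w.2, w.1)) = 0.
Proof.
move=> ig ig' gPQ.
pose G (mu : probability T R) := fine (\int[mu]_w \int[P]_w' (g (w, w'))%:E)%E.
have gE mu nu : (mu = P \/ mu = Q) -> (nu = P \/ nu = Q) ->
    \int[(mu \x nu)%E]_w g w = G mu.
  move=> hmu hnu; have := integral12_prod_meas1 (ig _ _ hmu hnu).
  rewrite /Rintegral => <-; rewrite /G /fubini_F/=; congr fine.
  by apply: eq_integral => w _; case: hnu => ->.
have gE' mu nu : (mu = P \/ mu = Q) -> (nu = P \/ nu = Q) ->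
    \int[(mu \x nu)%E]_w g (w.2, w.1) = G nu.
  move=> hmu hnu; rewrite -(gE _ _ hnu hmu) /Rintegral.
  rewrite -(integral21_prod_meas1 (ig' _ _ hmu hnu)).
  by rewrite -(integral12_prod_meas1 (ig _ _ hnu hmu)).
have sumE mu nu : (mu = P \/ mu = Q) -> (nu = P \/ nu = Q) ->
    \int[(mu \x nu)%E]_w (g w + g (w.2, w.1)) = G mu + G nu.
  by move=> hmu hnu; rewrite RintegralD ?gE ?gE'//; [exact: ig|exact: ig'].
by rewrite /energy !sumE; auto; ring.
Qed.

Lemma kernel_distance_sqrE (k : T -> T -> R) (H : rkhs k) P Q :
  has_mean_embedding H P -> has_mean_embedding H Q ->
  pair_integrable P Q (fun w => k w.1 w.2) ->
  kernel_distance H P Q ^+ 2 = energy P Q (fun w => k w.1 w.2).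
Proof.
move=> hP hQ ik.
have dotkE mu nu : has_mean_embedding H mu -> has_mean_embedding H nu ->
    (mu = P \/ mu = Q) -> (nu = P \/ nu = Q) ->
    rkhs_dot H (mean_embedding H mu) (mean_embedding H nu) =
    \int[(mu \x nu)%E]_w k w.1 w.2.
  move=> hmu hnu emu enu; rewrite /Rintegral.
  rewrite -(integral21_prod_meas1 (ik _ _ emu enu)) /fubini_G/=.
  by rewrite -(dot_mean_embedding hmu hnu).
rewrite /kernel_distance (normB2 (@rkhs_dotE _ _ _ H)) -!rkhs_dotE.
by rewrite !dotkE; auto.
Qed.

End energy.

(** * Couplings and integrability of products of kernels *)

Section couplings.
Context {d1 d2} {T1 : measurableType d1} {T2 : measurableType d2} {R : realType}.
Implicit Types (al : probability T1 R) (be : probability T2 R).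
Implicit Types mu : probability (T1 * T2)%type R.

Definition coupling al be mu :=
  (forall A, measurable A -> law1 mu A = al A) /\
  (forall B, measurable B -> law2 mu B = be B).

Lemma coupling_laws mu : coupling (law1 mu) (law2 mu) mu.
Proof. by []. Qed.

Lemma coupling_prod al be : coupling al be (al \x be)%E.
Proof.
split => [A mA|B mB].
  rewrite [LHS](_ : _ = (al \x be)%E (A `*` setT)).
    by rewrite product_measure1E// [X in (_ * X)%E](probability_setT be) mule1.
  by congr ((al \x be)%E _); apply/seteqP; split => [x|x []].
rewrite [LHS](_ : _ = (al \x be)%E (setT `*` B)).
  by rewrite product_measure1E// [X in (X * _)%E](probability_setT al) mul1e.
by congr ((al \x be)%E _); apply/seteqP; split => [x|x []].
Qed.

(** Both integrals are defined through the positive and negative parts of [f], for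
    which this is the change of variables for nonnegative functions. *)
Lemma integral_distributionE d (T : measurableType d) d' (T' : measurableType d')
    (P : probability T R) (X : {mfun T >-> T'}) (f : T' -> \bar R) :
  measurable_fun [set: T'] f ->
  (\int[distribution P X]_x f x = \int[P]_w f (X w))%E.
Proof.
move=> mf; rewrite [LHS]integralE [RHS]integralE.
rewrite !ge0_integral_distribution//.
- by rewrite -funepos_comp -funeneg_comp.
- exact: measurable_funeneg.
- exact: measurable_funepos.
Qed.

Lemma coupling_integral1 al be mu (f : T1 -> \bar R) :
  coupling al be mu -> measurable_fun [set: T1] f ->
  (\int[mu]_w f w.1 = \int[al]_x f x)%E.
Proof.
move=> [h _] mf; rewrite -(integral_distributionE mu fst)//.
by apply: eq_measure_integral => A mA _; exact: h.
Qed.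

Lemma coupling_integral2 al be mu (f : T2 -> \bar R) :
  coupling al be mu -> measurable_fun [set: T2] f ->
  (\int[mu]_w f w.2 = \int[be]_x f x)%E.
Proof.
move=> [_ h] mf; rewrite -(integral_distributionE mu snd)//.
by apply: eq_measure_integral => A mA _; exact: h.
Qed.

Lemma coupling_integrable1 al be mu (f : T1 -> \bar R) :
  coupling al be mu -> al.-integrable [set: T1] f ->
  mu.-integrable [set: T1 * T2] (fun w => f w.1).
Proof.
move=> cmu /integrableP[mf foo]; apply/integrableP; split.
  exact: (measurableT_comp mf).
rewrite (coupling_integral1 (f := fun x => `|f x|%E) cmu)//.
exact: measurableT_comp.
Qed.

Lemma coupling_integrable2 al be mu (f : T2 -> \bar R) :
  coupling al be mu -> be.-integrable [set: T2] f ->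
  mu.-integrable [set: T1 * T2] (fun w => f w.2).
Proof.
move=> cmu /integrableP[mf foo]; apply/integrableP; split.
  exact: (measurableT_comp mf).
rewrite (coupling_integral2 (f := fun x => `|f x|%E) cmu)//.
exact: measurableT_comp.
Qed.

End couplings.

Definition dominated {R : realType} {T : Type} (p : T -> T -> R) (a : T -> R) :=
  forall x x', `|p x x'| <= a x + a x'.

Section cross_integrals.
Context {d1 d2} {T1 : measurableType d1} {T2 : measurableType d2} {R : realType}.
Implicit Types (mu nu : probability (T1 * T2)%type R).

Lemma measurable_prod_kernel (p : T1 -> T1 -> R) (q : T2 -> T2 -> R) :
  jointly_measurable p -> jointly_measurable q ->
  jointly_measurable (prod_kernel p q).
Proof.
move=> mp mq.
have m1 : measurable_fun [set: (T1 * T2) * (T1 * T2)] (fun w => (w.1.1, w.2.1)).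
  by apply: measurable_fun_pair; apply: (measurableT_comp measurable_fst).
have m2 : measurable_fun [set: (T1 * T2) * (T1 * T2)] (fun w => (w.1.2, w.2.2)).
  by apply: measurable_fun_pair; apply: (measurableT_comp measurable_snd).
exact: measurable_funM (measurableT_comp mp m1) (measurableT_comp mq m2).
Qed.

Lemma jointly_measurable_sec d (T : measurableType d) (p : T -> T -> R) x' :
  jointly_measurable p -> measurable_fun [set: T] (p ^~ x').
Proof. exact: measurable_fun_pair1. Qed.

Lemma jointly_measurable_diag d (T : measurableType d) (p : T -> T -> R) :
  jointly_measurable p -> measurable_fun [set: T] (fun x => p x x).
Proof.
move=> mp.
have m : measurable_fun [set: T] (fun x => (x, x)) by apply: measurable_fun_pair.
exact: (measurableT_comp mp m).
Qed.

Variables (al : probability T1 R) (be : probability T2 R).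
Variables (a : T1 -> R) (b : T2 -> R).
Hypothesis ia : al.-integrable [set: T1] (EFin \o (fun x => a x ^+ 2)).
Hypothesis ib : be.-integrable [set: T2] (EFin \o (fun y => b y ^+ 2)).

Lemma integrable_sqr_sum mu : coupling al be mu ->
  mu.-integrable [set: T1 * T2] (EFin \o (fun w => a w.1 ^+ 2 + b w.2 ^+ 2)).
Proof.
move=> cmu; exact: (integrableD measurableT
  (coupling_integrable1 cmu ia) (coupling_integrable2 cmu ib)).
Qed.

(** By the arithmetic-geometric inequality,
    [(a x + a x') (b y + b y') <= a x ^ 2 + a x' ^ 2 + b y ^ 2 + b y' ^ 2],
    where each term depends on one coordinate only; hence second moments of the
    marginals suffice, whatever the couplings. *)
Lemma integrable_prod_kernel mu nu (p : T1 -> T1 -> R) (q : T2 -> T2 -> R) :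
  coupling al be mu -> coupling al be nu ->
  jointly_measurable p -> jointly_measurable q ->
  dominated p a -> dominated q b ->
  (mu \x nu)%E.-integrable [set: (T1 * T2) * (T1 * T2)]
    (EFin \o (fun w => prod_kernel p q w.1 w.2)).
Proof.
move=> cmu cnu mp mq pa qb.
pose s (w : T1 * T2) := a w.1 ^+ 2 + b w.2 ^+ 2.
apply: (@le_integrable _ _ _ _ _ measurableT _
  (EFin \o (fun w : (T1 * T2) * (T1 * T2) => s w.1 + s w.2))).
- by apply/measurable_EFinP; exact: measurable_prod_kernel.
- move=> [[x y] [x' y']] _ /=; rewrite lee_fin /prod_kernel/s/= normrM.
  rewrite [leRHS]ger0_norm; last by rewrite !addr_ge0 ?sqr_ge0.
  apply: (le_trans (ler_pM _ _ (pa x x') (qb y y'))) => //.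
  have h1 := sqr_ge0 (a x + a x' - (b y + b y')).
  have h2 := sqr_ge0 (a x - a x'); have h3 := sqr_ge0 (b y - b y'); nra.
- exact: (integrableD measurableT
    (coupling_integrable1 (coupling_prod mu nu) (integrable_sqr_sum cmu))
    (coupling_integrable2 (coupling_prod mu nu) (integrable_sqr_sum cnu))).
Qed.

End cross_integrals.

(** * Positive definite kernels and the semimetrics they induce *)

Section positive_definite_kernels.
Context {R : realType} {T : Type} (k : T -> T -> R).
Hypothesis pk : posdef_kernel k.

Lemma posdef_diag_ge0 x : 0 <= k x x.
Proof. by have := pk.2 1 (fun=> x) (fun=> 1); rewrite !big_ord1 !mul1r. Qed.

(** Positivity of the quadratic form at the weights [(1, 1)] and [(1, -1)]. *)
Lemma posdef_norm_le x x' : `|k x x'| <= (k x x + k x' x') / 2.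
Proof.
have h s := pk.2 2 (fun i => if i == 0 then x else x') (fun i => if i == 0 then 1 else s).
have h1 := h 1; have h2 := h (-1); move: h1 h2.
rewrite !big_ord_recl !big_ord0/= (pk.1 x' x) ler_norml; lra.
Qed.

Lemma posdef_dominated : dominated k (fun x => k x x).
Proof.
move=> x x'; have := posdef_norm_le x x'.
by have := posdef_diag_ge0 x; have := posdef_diag_ge0 x'; lra.
Qed.

Lemma kernel_induced_dominated rho :
  kernel_induced k rho -> dominated rho (fun x => k x x).
Proof.
move=> krho x x'; rewrite krho.
by have := posdef_norm_le x x'; rewrite !ler_norml; lra.
Qed.

End positive_definite_kernels.

Lemma kernel_induced_measurable {R : realType} {d} {T : measurableType d}
    (k rho : T -> T -> R) :
  jointly_measurable k -> kernel_induced k rho -> jointly_measurable rho.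
Proof.
move=> mk krho.
have md := jointly_measurable_diag mk.
rewrite /jointly_measurable.
have -> : (fun w : T * T => rho w.1 w.2) =
    (fun w => (k w.1 w.1 + k w.2 w.2) * 2^-1 - k w.1 w.2).
  by apply/funext => w; rewrite krho.
apply: measurable_funB => //; apply: measurable_funM => //.
by apply: measurable_funD;
  [exact: (measurableT_comp md measurable_fst)|exact: (measurableT_comp md measurable_snd)].
Qed.

Lemma moment_k_integrable {R : realType} d (T : measurableType d) (mu : probability T R)
    (k : T -> T -> R) :
  jointly_measurable k -> moment_k 2 k mu ->
  mu.-integrable [set: T] (EFin \o (fun x => k x x ^+ 2)).
Proof.
move=> mk mom; apply/integrableP; split.
  by apply/measurable_EFinP; apply: measurable_funX; exact: jointly_measurable_diag.
by under eq_integral do rewrite /= ger0_norm ?sqr_ge0//.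
Qed.

(** * Invariance of the energy under kernel-induced semimetrics *)

Section kernel_induced_energy.
Context {d1 d2} {T1 : measurableType d1} {T2 : measurableType d2} {R : realType}.
Variables (al : probability T1 R) (be : probability T2 R).
Variables (k1 rho1 : T1 -> T1 -> R) (k2 rho2 : T2 -> T2 -> R).
Hypotheses (pk1 : posdef_kernel k1) (pk2 : posdef_kernel k2).
Hypotheses (mk1 : jointly_measurable k1) (mk2 : jointly_measurable k2).
Hypothesis ik1 : al.-integrable [set: T1] (EFin \o (fun x => k1 x x ^+ 2)).
Hypothesis ik2 : be.-integrable [set: T2] (EFin \o (fun y => k2 y y ^+ 2)).
Implicit Types mu nu : probability (T1 * T2)%type R.

Lemma pair_integrable_prod_kernel mu nu (p : T1 -> T1 -> R) (q : T2 -> T2 -> R) :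
  coupling al be mu -> coupling al be nu ->
  jointly_measurable p -> jointly_measurable q ->
  dominated p (fun x => k1 x x) -> dominated q (fun y => k2 y y) ->
  pair_integrable mu nu (fun w => prod_kernel p q w.1 w.2).
Proof.
move=> cmu cnu mp mq pk qk m n hm hn.
by apply: (integrable_prod_kernel ik1 ik2) => //; [case: hm|case: hn] => ->.
Qed.

(** With [a x = k1 x x / 2] and [b y = k2 y y / 2], the difference
    [rho1 rho2 - k1 k2] is the symmetrisation of [g1 = a(x) rho2(y, y')] minus that
    of [g2 = k1(x, x') b(y)]. In [g1] and [g2] the second point occurs only through
    [y'], respectively [x'], so that its law matters only through a marginal. *)
Lemma energy_kernel_induced mu nu :
  coupling al be mu -> coupling al be nu ->
  kernel_induced k1 rho1 -> kernel_induced k2 rho2 ->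
  energy mu nu (fun w => prod_kernel rho1 rho2 w.1 w.2) =
  energy mu nu (fun w => prod_kernel k1 k2 w.1 w.2).
Proof.
move=> cmu cnu kr1 kr2.
have rsym2 y y' : rho2 y y' = rho2 y' y by rewrite !kr2 (pk2.1 y' y) (addrC (k2 y' y')).
have mr2 := kernel_induced_measurable mk2 kr2.
have dk1 := posdef_dominated pk1; have dk2 := posdef_dominated pk2.
have dr2 := kernel_induced_dominated pk2 kr2.
have md1 := jointly_measurable_diag mk1; have md2 := jointly_measurable_diag mk2.
pose a x := k1 x x / 2; pose b y := k2 y y / 2.
have ma : measurable_fun setT a by apply: measurable_funM.
have mb : measurable_fun setT b by apply: measurable_funM.
have a0 x : 0 <= k1 x x := posdef_diag_ge0 pk1 x.
have b0 y : 0 <= k2 y y := posdef_diag_ge0 pk2 y.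
have PI := pair_integrable_prod_kernel cmu cnu.
pose g1 w := prod_kernel (fun x _ => a x) rho2 w.1 w.2.
pose g2 w := prod_kernel k1 (fun y _ => b y) w.1 w.2.
have ma1 : jointly_measurable (fun x _ : T1 => a x) by exact: (measurableT_comp ma).
have ma2 : jointly_measurable (fun _ x' : T1 => a x') by exact: (measurableT_comp ma).
have mb1 : jointly_measurable (fun y _ : T2 => b y) by exact: (measurableT_comp mb).
have mb2 : jointly_measurable (fun _ y' : T2 => b y') by exact: (measurableT_comp mb).
have da1 : dominated (fun x _ => a x) (fun x => k1 x x).
  by move=> x x'; rewrite ger0_norm /a; have := a0 x; have := a0 x'; lra.
have da2 : dominated (fun _ x' => a x') (fun x => k1 x x).
  by move=> x x'; rewrite addrC; exact: da1.
have db1 : dominated (fun y _ => b y) (fun y => k2 y y).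
  by move=> y y'; rewrite ger0_norm /b; have := b0 y; have := b0 y'; lra.
have db2 : dominated (fun _ y' => b y') (fun y => k2 y y).
  by move=> y y'; rewrite addrC; exact: db1.
have ig1 : pair_integrable mu nu g1 by exact: PI.
have ig2 : pair_integrable mu nu g2 by exact: PI.
have ig1' : pair_integrable mu nu (fun w => g1 (w.2, w.1)).
  rewrite (_ : (fun w => _) = fun w => prod_kernel (fun _ x' => a x') rho2 w.1 w.2).
    exact: PI.
  by apply/funext => w; rewrite /g1/prod_kernel/= rsym2.
have ig2' : pair_integrable mu nu (fun w => g2 (w.2, w.1)).
  rewrite (_ : (fun w => _) = fun w => prod_kernel k1 (fun _ y' => b y') w.1 w.2).
    exact: PI.
  by apply/funext => w; rewrite /g2/prod_kernel/= pk1.1.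
have addI h g : pair_integrable mu nu h -> pair_integrable mu nu g ->
    pair_integrable mu nu (fun w => h w + g w).
  move=> ih ig m n hm hn.
  exact: (integrableD measurableT (ih _ _ hm hn) (ig _ _ hm hn)).
have subI h g : pair_integrable mu nu h -> pair_integrable mu nu g ->
    pair_integrable mu nu (fun w => h w - g w).
  move=> ih ig m n hm hn.
  exact: (integrableB measurableT (ih _ _ hm hn) (ig _ _ hm hn)).
have -> : (fun w => prod_kernel rho1 rho2 w.1 w.2) = (fun w =>
    (g1 w + g1 (w.2, w.1)) - (g2 w + g2 (w.2, w.1)) + prod_kernel k1 k2 w.1 w.2).
  apply/funext => -[[x y] [x' y']].
  by rewrite /g1/g2/prod_kernel/= (rsym2 y' y) (pk1.1 x' x) kr1 kr2 /a/b; field.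
rewrite energyD//; [|by apply: subI; apply: addI|exact: PI].
rewrite energyB//; [|exact: addI|exact: addI].
rewrite !energy_sym_eq0 ?subrr ?add0r//.
- move=> w; rewrite /g2/prod_kernel/=.
  have mf : measurable_fun setT (fun x' => (k1 w.1 x' * b w.2)%:E).
    apply/measurable_EFinP; apply: measurable_funM => //.
    exact: measurable_fun_pair2 mk1.
  by rewrite (coupling_integral1 cmu mf) (coupling_integral1 cnu mf).
- move=> w; rewrite /g1/prod_kernel/=.
  have mf : measurable_fun setT (fun y' => (a w.1 * rho2 w.2 y')%:E).
    apply/measurable_EFinP; apply: measurable_funM => //.
    exact: measurable_fun_pair2 mr2.
  by rewrite (coupling_integral2 cmu mf) (coupling_integral2 cnu mf).
Qed.

End kernel_induced_energy.

(** * Distance covariance as an energy *)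

Section distance_covariance.
Context {d1 d2} {T1 : measurableType d1} {T2 : measurableType d2} {R : realType}.

Lemma ge0_integral_prodM (al : probability T1 R) (be : probability T2 R)
    (f : T1 -> \bar R) (g : T2 -> \bar R) :
  measurable_fun [set: T1] f -> measurable_fun [set: T2] g ->
  (forall x, 0 <= f x)%E -> (forall y, 0 <= g y)%E ->
  (\int[(al \x be)%E]_w (f w.1 * g w.2) =
   (\int[al]_x f x) * (\int[be]_y g y))%E.
Proof.
move=> mf mg f0 g0.
have mfg : measurable_fun [set: T1 * T2] (fun w => f w.1 * g w.2)%E.
  by apply: emeasurable_funM; [exact: (measurableT_comp mf)|exact: (measurableT_comp mg)].
rewrite fubini_tonelli1//; last by move=> w; rewrite mule_ge0.
rewrite /fubini_F/= -ge0_integralZr//; last exact: integral_ge0.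
by apply: eq_integral => x _; rewrite ge0_integralZl.
Qed.

Variable P : probability (T1 * T2)%type R.

(** The three terms of [dcov2] are the integrals of [rho1 rho2] against
    [P \x P], [Q \x Q] and [P \x Q] for [Q = law_prod P]: wherever a point has
    law [Q], integrating it out factors over the marginals. *)
Lemma dcov2_energy (rho1 : T1 -> T1 -> R) (rho2 : T2 -> T2 -> R) :
  (forall x x', 0 <= rho1 x x') -> (forall y y', 0 <= rho2 y y') ->
  jointly_measurable rho1 -> jointly_measurable rho2 ->
  pair_integrable P (law_prod P) (fun w => prod_kernel rho1 rho2 w.1 w.2) ->
  dcov2 P rho1 rho2 =
  (energy P (law_prod P) (fun w => prod_kernel rho1 rho2 w.1 w.2))%:E.
Proof.
move=> r1 r2 m1 m2 ir.
pose h (w : (T1 * T2) * (T1 * T2)) := (prod_kernel rho1 rho2 w.1 w.2)%:E.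
have h0 w : (0 <= h w)%E by rewrite lee_fin mulr_ge0.
have mh : measurable_fun setT h.
  by apply/measurable_EFinP; exact: measurable_prod_kernel.
pose f x := (\int[law1 P]_x' (rho1 x x')%:E)%E.
pose g y := (\int[law2 P]_y' (rho2 y y')%:E)%E.
have f0 x : (0 <= f x)%E by apply: integral_ge0 => x' _; rewrite lee_fin.
have g0 y : (0 <= g y)%E by apply: integral_ge0 => y' _; rewrite lee_fin.
have mf : measurable_fun setT f.
  apply: (measurable_fun_fubini_tonelli_F (fun w => (rho1 w.1 w.2)%:E)).
    exact/measurable_EFinP.
  by move=> w; rewrite lee_fin.
have mg : measurable_fun setT g.
  apply: (measurable_fun_fubini_tonelli_F (fun w => (rho2 w.1 w.2)%:E)).
    exact/measurable_EFinP.
  by move=> w; rewrite lee_fin.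
have inner w : (\int[law_prod P]_w' h (w, w') = f w.1 * g w.2)%E.
  rewrite /law_prod -ge0_integral_prodM//.
  - exact/measurable_EFinP/(measurable_fun_pair2 _ m1).
  - exact/measurable_EFinP/(measurable_fun_pair2 _ m2).
  - by move=> x; rewrite lee_fin.
  - by move=> y; rewrite lee_fin.
have RE mu nu : (mu = P \/ mu = law_prod P) -> (nu = P \/ nu = law_prod P) ->
    (\int[(mu \x nu)%E]_w prod_kernel rho1 rho2 w.1 w.2)%:E =
    (\int[mu]_w \int[nu]_w' h (w, w'))%E.
  move=> hmu hnu; rewrite /Rintegral fineK; first by rewrite (fubini_tonelli1 h).
  exact: integrable_fin_num (ir _ _ hmu hnu).
rewrite /energy EFinD EFinN EFinM EFinD !RE; auto.
rewrite /dcov2; congr (_ + _ - _ * _)%E.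
- under [RHS]eq_integral do rewrite inner.
  by rewrite ge0_integral_prodM.
- by under [RHS]eq_integral do rewrite inner.
Qed.

Lemma dcov2_kernel_distance (k1 rho1 : T1 -> T1 -> R) (k2 rho2 : T2 -> T2 -> R)
    (H : rkhs (prod_kernel k1 k2)) :
  posdef_kernel k1 -> jointly_measurable k1 ->
  posdef_kernel k2 -> jointly_measurable k2 ->
  moment_k 2 k1 (law1 P) -> moment_k 2 k2 (law2 P) ->
  semimetric rho1 -> semimetric rho2 ->
  kernel_induced k1 rho1 -> kernel_induced k2 rho2 ->
  [/\ has_mean_embedding H P, has_mean_embedding H (law_prod P) &
      dcov2 P rho1 rho2 = (kernel_distance H P (law_prod P) ^+ 2)%:E].
Proof.
move=> pk1 mk1 pk2 mk2 mom1 mom2 [r1 _ _] [r2 _ _] kr1 kr2.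
have ik1 := moment_k_integrable mk1 mom1.
have ik2 := moment_k_integrable mk2 mom2.
have cP := coupling_laws P.
have cQ : coupling (law1 P) (law2 P) (law_prod P) := coupling_prod _ _.
have PI := pair_integrable_prod_kernel ik1 ik2 cP cQ.
have mK := measurable_prod_kernel mk1 mk2.
have mKx w : measurable_fun [set: T1 * T2] ((prod_kernel k1 k2) ^~ w).
  exact: jointly_measurable_sec.
have mean mu : coupling (law1 P) (law2 P) mu -> has_mean_embedding H mu.
  move=> cmu; apply: mean_embedding_exists => //.
  apply: (@le_integrable _ _ _ mu _ measurableT _
    (EFin \o (fun w => 1 + (k1 w.1 w.1 ^+ 2 + k2 w.2 w.2 ^+ 2)))).
  - apply/measurable_EFinP.
    exact: (measurableT_comp (continuous_measurable_fun (@sqrt_continuous R))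
      (jointly_measurable_diag mK)).
  (* [sqrt (s t) <= 1 + s t <= 1 + (s ^ 2 + t ^ 2)] *)
  - move=> [x y] _ /=; rewrite lee_fin /prod_kernel/=.
    have x0 := posdef_diag_ge0 pk1 x; have y0 := posdef_diag_ge0 pk2 y.
    rewrite !ger0_norm ?sqrtr_ge0 ?addr_ge0 ?sqr_ge0//.
    have := sqr_sqrtr (mulr_ge0 x0 y0).
    have := sqr_ge0 (Num.sqrt (k1 x x * k2 y y) - 1).
    have := sqr_ge0 (k1 x x - k2 y y).
    have := sqr_ge0 (k1 x x); have := sqr_ge0 (k2 y y).
    move: (Num.sqrt _) => s; nra.
  - exact: (integrableD measurableT (finite_measure_integrable_cst mu 1 measurableT)
      (integrable_sqr_sum ik1 ik2 cmu)).
split; [exact: mean|exact: mean|].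
rewrite dcov2_energy//; last first.
- by apply: PI; [exact: kernel_induced_measurable kr1|
    exact: kernel_induced_measurable kr2|exact: kernel_induced_dominated|
    exact: kernel_induced_dominated].
- exact: kernel_induced_measurable kr2.
- exact: kernel_induced_measurable kr1.
rewrite kernel_distance_sqrE; [|exact: mean|exact: mean|].
  by rewrite (energy_kernel_induced pk1 pk2 mk1 mk2 ik1 ik2 cP cQ kr1 kr2).
by apply: PI => //; exact: posdef_dominated.
Qed.

End distance_covariance.

(** * Distance-induced kernels *)

Section distance_induced_kernels.
Context {d} {T : measurableType d} {R : realType}.
Implicit Types rho k : T -> T -> R.

(** Since [rho] vanishes on the diagonal, [k(x, x) = 2 rho(x, theta)]. *)
Lemma distance_induced_kernel_induced rho k :
  semimetric rho -> distance_induced rho k -> kernel_induced k rho.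
Proof.
move=> [_ r0 _] [t kE] x x'; rewrite !kE.
have rxx y : rho y y = 0 by apply/r0.
by rewrite !rxx; field.
Qed.

(** Negative type at the points [x], [z], [y] with weights [1], [1], [-2]. In terms
    of the embedding [rho(x, z) = |phi x - phi z|^2] this is the parallelogram
    law. *)
Lemma negative_type_relaxed_triangle rho x y z :
  semimetric rho -> negative_type rho -> rho x z <= 2 * (rho x y + rho y z).
Proof.
move=> [_ r0 rs] nt.
have rxx w : rho w w = 0 by apply/r0.
have := nt 3 (tnth [tuple x; z; y]) (tnth [tuple 1; 1; -2]) isT.
rewrite !big_ord_recl !big_ord0 !(tnth_nth x) !(tnth_nth 0)/= !rxx.
rewrite (rs z x) (rs y x) (rs z y) => h.
have : 1 + (1 + (-2 + 0)) = 0 :> R by lra.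
by move=> /h; lra.
Qed.

Lemma moment_rho_moment_k (P : probability T R) rho k :
  semimetric rho -> negative_type rho -> jointly_measurable k ->
  distance_induced rho k -> moment_rho 2 rho P -> moment_k 2 k P.
Proof.
move=> sr nr mk dk [x0 mom].
have [r0 _ rs] := sr; have [t kE] := dk.
have mr := kernel_induced_measurable mk (distance_induced_kernel_induced sr dk).
pose c := rho x0 t.
have ir : P.-integrable [set: T] (EFin \o (fun x => rho x x0 ^+ 2)).
  apply/integrableP; split.
    apply/measurable_EFinP; apply: measurable_funX.
    exact: jointly_measurable_sec.
  by under eq_integral do rewrite /= ger0_norm ?sqr_ge0//.
(* [k(x, x) = 2 rho(x, t) <= 4 (rho(x, x0) + c)], whose square is at most
   [32 rho(x, x0) ^ 2 + 32 c ^ 2]. *)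
have ib := integrableD measurableT (integrableZl measurableT 32 ir)
  (finite_measure_integrable_cst P (32 * c ^+ 2) measurableT).
apply: le_lt_trans (integrable_lty measurableT ib).
apply: ge0_le_integral => //.
- by move=> x _; rewrite lee_fin sqr_ge0.
- apply/measurable_EFinP; apply: measurable_funX; exact: jointly_measurable_diag.
- exact: measurable_int ib.
- move=> x _ /=; rewrite lee_fin kE.
  have -> : rho x x = 0 by have [_ h _] := sr; apply/h.
  have := negative_type_relaxed_triangle x x0 t sr nr; rewrite -/c.
  have := r0 x t; have := sqr_ge0 (rho x x0 - c); nra.
Qed.

End distance_induced_kernels.

(** * The equivalence *)

Theorem theorem1 (R : realType) (d dX dY dZ : measure_display)
    (Omega : measurableType d) (TX : measurableType dX)
    (TY : measurableType dY) (TZ : measurableType dZ)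
    (P : probability Omega R)
    (X : {mfun Omega >-> TX}) (Y : {mfun Omega >-> TY})
    (Z : {mfun Omega >-> TZ})
    (PXY : TZ -> probability (TX * TY)%type R)
    (PXY_cond : is_cond_law P (fun w => (X w, Y w)) Z PXY) :
  (forall (rhoX : TX -> TX -> R) (rhoY : TY -> TY -> R)
      (kX : TX -> TX -> R) (kY : TY -> TY -> R)
      (H : rkhs (prod_kernel kX kY)),
    semimetric rhoX -> negative_type rhoX ->
    semimetric rhoY -> negative_type rhoY ->
    (forall z, moment_rho 2 rhoX (law1 (PXY z)) /\
               moment_rho 2 rhoY (law2 (PXY z))) ->
    posdef_kernel kX -> jointly_measurable kX ->
    posdef_kernel kY -> jointly_measurable kY ->
    distance_induced rhoX kX -> distance_induced rhoY kY ->
    forall z,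
      [/\ has_mean_embedding H (PXY z),
          has_mean_embedding H (law_prod (PXY z)) &
          dcov2 (PXY z) rhoX rhoY =
          (kernel_distance H (PXY z) (law_prod (PXY z)) ^+ 2)%:E])
  /\
  (forall (kX : TX -> TX -> R) (kY : TY -> TY -> R)
      (rhoX : TX -> TX -> R) (rhoY : TY -> TY -> R)
      (H : rkhs (prod_kernel kX kY)),
    posdef_kernel kX -> jointly_measurable kX ->
    posdef_kernel kY -> jointly_measurable kY ->
    (forall z, moment_k 2 kX (law1 (PXY z)) /\
               moment_k 2 kY (law2 (PXY z))) ->
    semimetric rhoX -> semimetric rhoY ->
    kernel_induced kX rhoX -> kernel_induced kY rhoY ->
    forall z,
      [/\ has_mean_embedding H (PXY z),
          has_mean_embedding H (law_prod (PXY z)) &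
          dcov2 (PXY z) rhoX rhoY =
          (kernel_distance H (PXY z) (law_prod (PXY z)) ^+ 2)%:E]).
Proof.
split.
- move=> rhoX rhoY kX kY H srX nrX srY nrY mom pX mX pY mY dX' dY' z.
  have [momX momY] := mom z.
  apply: (dcov2_kernel_distance H pX mX pY mY) => //.
  + exact: (moment_rho_moment_k srX nrX mX dX' momX).
  + exact: (moment_rho_moment_k srY nrY mY dY' momY).
  + exact: distance_induced_kernel_induced.
  + exact: distance_induced_kernel_induced.
- move=> kX kY rhoX rhoY H pX mX pY mY mom srX srY iX iY z.
  have [momX momY] := mom z.
  exact: (dcov2_kernel_distance H pX mX pY mY).
Qed.
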